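(* Let $G$ be a modular abelian independence group and let $n$ be a natural number. Suppose $A,B$ are flats of $G$, both of rank $n$. Then $A$ is matched to $B$ if and only if, for every pair of nonempty flats $S\subseteq A$ and $R\subseteq\operatorname{cl}(B\cup\{1\})$ with $SR=S$, we have $$\rho(S)+\rho(R\cap B)\leq n.$$
   Context: Natural numbers are positive integers. A finitary matroid is a pair $(E,\mathcal{I})$ consisting of a set $E$ and a nonempty collection $\mathcal{I}$ of subsets of $E$ (called the independent sets) such that: (I1) if $A\in\mathcal{I}$ and $B\subseteq A$ then $B\in\mathcal{I}$; (I2) if $A,B$ are finite elements of $\mathcal{I}$ with $|B|=|A|+1$, then there is $x\in B\setminus A$ with $\{x\}\cup A\in\mathcal{I}$; (I3) if $A\subseteq E$ and every finite subset of $A$ belongs to $\mathcal{I}$, then $A\in\mathcal{I}$. The collection $\mathcal{I}$ is called an independence structure on $E$. A basis of a subset $A\subseteq E$ is an inclusion-maximal independent subset of $A$; any two bases of $A$ have the same cardinality, and the rank $\rho(A)$ is that cardinal number; $A$ has finite rank if $\rho(A)$ is a nonnegative integer. An element $x\in E$ depends on $A\subseteq E$ if either $x\in A$, or $x\notin A$ and $\{x\}\cup B\notin\mathcal{I}$ for some independent $B\subseteq A$. The closure is $\operatorname{cl}(A)=\{x\in E: x\text{ depends on }A\}$, and $A$ is a flat if $\operatorname{cl}(A)=A$. The finitary matroid is modular if $\rho(A)+\rho(B)=\rho(A\cup B)+\rho(A\cap B)$ (as cardinals) for all flats $A,B$. An independence group is a group $G$ (written multiplicatively, with identity $1$) together with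 an independence structure $\mathcal{I}$ on the set $G$ such that for every $g\in G$ and $A\subseteq G$ one has $gA\in\mathcal{I}$ if and only if $A\in\mathcal{I}$, where $gA=\{gx:x\in A\}$. A modular abelian independence group is an independence group that is modular as a finitary matroid and whose group is abelian. For $X,Y\subseteq G$, $XY=\{xy:x\in X,y\in Y\}$. Let $A,B$ be subsets of $G$ with $\rho(A)=\rho(B)$ finite. $A$ is matched to $B$ if for every basis $\mathcal{A}$ of $A$ and every basis $\mathcal{B}$ of $B$ there exists a bijection $f:\mathcal{A}\to\mathcal{B}$ such that $af(a)\notin A$ for all $a\in\mathcal{A}$. *)

(* Defs.v *)
From mathcomp Require Import all_boot.
From mathcomp Require Import all_classical.

Set Implicit Arguments.
Unset Strict Implicit.
Unset Printing Implicit Defensive.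

Local Open Scope classical_set_scope.
Local Open Scope card_scope.
Local Open Scope group_scope.

Record finitary_matroid (E : choiceType) (I : set (set E)) : Prop := {
  indep_nonempty : I !=set0;
  indep_sub : forall A B : set E, I A -> B `<=` A -> I B;
  indep_exchange : forall (k : nat) (A B : set E),
    I A -> I B -> A #= `I_k -> B #= `I_k.+1 ->
    exists x, (B `\` A) x /\ I ([set x] `|` A);
  indep_finitary : forall A : set E,
    (forall F : set E, F `<=` A -> finite_set F -> I F) -> I A }.

Definition is_basis (E : choiceType) (I : set (set E)) (A X : set E) : Prop :=
  [/\ X `<=` A, I X & forall Y, Y `<=` A -> I Y -> X `<=` Y -> Y = X].

Lemma ex_basis (E : choiceType) (I : set (set E)) (A : set E) :
  finitary_matroid I -> exists X, is_basis I A X.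
Proof.
move=> [[Z IZ] I1 _ I3].
have [F FP Ftot|X [[XA IX] Xmax]] :=
    @Zorn_bigcup E [set X | X `<=` A /\ I X].
  split=> [x [X FX Xx]|]; first by have [XA _] := FP _ FX; exact: XA.
  apply: I3 => _ /[swap] /finite_seqP[s ->] sF.
  have [->|s0] := eqVneq s [::].
    by apply: I1 IZ _ => x.
  have [X FX sX] : exists2 X, F X & [set` s] `<=` X.
    elim: s s0 sF => // x s IHs _ sF.
    have [X FX Xx] := sF x (mem_head x s).
    have [->|s0] := eqVneq s [::].
      by exists X => // y /=; rewrite inE => /eqP->.
    have [y ys|Y FY sY] := IHs s0.
      by apply: sF; rewrite /= inE; apply/orP; right.
    have [XY|YX] := Ftot _ _ FX FY.
      exists Y => // y /=; rewrite inE => /orP[/eqP->|/sY//]; exact: XY.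
    by exists X => // y /=; rewrite inE => /orP[/eqP->//|/sY/YX].
  by apply: I1 sX; have [] := FP _ FX.
exists X; split=> // Y YA IY XY; apply/seteqP; split=> //.
apply: contrapT => YX; exact: (Xmax Y).
Qed.

(* Any two bases of A are equinumerous, so the cardinal rho(A) is represented
   by a chosen basis of A; such representatives are meant to be compared only
   through #= and #<=. By ex_basis, the default value set0 is not used when I
   is a finitary matroid. *)
Definition rank (E : choiceType) (I : set (set E)) (A : set E) : set E :=
  xget set0 [set X | is_basis I A X].

(* The disjoint union of X and Y, which represents the sum of cardinals. *)
Definition cardinal_sum (T U : Type) (X : set T) (Y : set U) : set (T + U) :=
  (inl @` X) `|` (inr @` Y).

Definition depends_on (E : choiceType) (I : set (set E)) (x : E) (A : set E) :
    Prop :=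
  A x \/
  (~ A x /\ exists B : set E, [/\ I B, B `<=` A & ~ I ([set x] `|` B)]).

Definition cl (E : choiceType) (I : set (set E)) (A : set E) : set E :=
  [set x | depends_on I x A].

Definition flat (E : choiceType) (I : set (set E)) (A : set E) : Prop :=
  cl I A = A.

Definition modular (E : choiceType) (I : set (set E)) : Prop :=
  forall A B : set E, flat I A -> flat I B ->
    cardinal_sum (rank I A) (rank I B) #=
    cardinal_sum (rank I (A `|` B)) (rank I (A `&` B)).

Definition set_mul (G : groupType) (X Y : set G) : set G :=
  [set x * y | x in X & y in Y].

Record independence_group (G : groupType) (I : set (set G)) : Prop := {
  indep_matroid : finitary_matroid I;
  indep_translate : forall (g : G) (A : set G),
    I [set g * x | x in A] <-> I A }.

Record modular_abelian_independence_group (G : groupType) (I : set (set G)) :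
    Prop := {
  mai_group : independence_group I;
  mai_modular : modular I;
  mai_abelian : forall x y : G, x * y = y * x }.

(* Meant for A and B of the same finite rank. *)
Definition matched (G : groupType) (I : set (set G)) (A B : set G) : Prop :=
  forall X Y : set G, is_basis I A X -> is_basis I B Y ->
    exists f : G -> G, set_bij X Y f /\ forall a, X a -> ~ A (a * f a).

(* Main.v *)
Require Import Defs.
From mathcomp Require Import all_boot.
From mathcomp Require Import all_classical.
From mathcomp Require Import finmap zify.

(** Let [rho] be the rank.  A failure of matching is first turned into a pair
    of independent sets: Hall's theorem ([hall_bijection]), applied to bases of
    [A] and [B], says that [A] fails to be matched to [B] exactly when there
    are independent sets [J] in [A] and [L] in [B] with [J L] inside [A] and
    [|J| + |L| > n].  The condition is then clearly necessary: if [S R = S]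
    with [S] in [A], bases [J] of [S] and [L] of [R `&` B] have [J L] inside
    [A], so they must satisfy [|J| + |L| <= n].

    Conversely, given [J] and [L], put [S = cl J] and [R = cl (L `|` {1})].
    Translates of flats are flats, so [S R] still lies in the flat [A]
    ([set_mul_cl]).  If [S R] is not inside [S], there is [e] in [S] with [e R]
    not inside [S], and the Dyson transform

      [S' = cl (S `|` e R)],   [R' = R `&` e^-1 S]

    produces another pair of flats with [S' R'] inside [A] and [1] in [R'].
    Since [e R' = S `&` e R], modularity yields
    [rho S' + rho R' = rho S + rho R], while [rho R' < rho R].  After finitely
    many steps [S R = S] ([dyson_stable_pair]).

    What the condition measures is [rho (R `&` B)] rather than [rho R], but the
    two differ by a constant along this process: as [R] contains [1] and lies
    in [cl (B `|` {1})], modularity gives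
    [rho (R `&` B) = rho R + n - rho (B `|` {1})]
    ([has_rank_setI_hyperplane]).  So [rho S + rho (R `&` B)] is invariant too;
    it is at least [|J| + |L| > n] at the start, and the final pair violates
    the condition. *)

Set Implicit Arguments.
Unset Strict Implicit.
Unset Printing Implicit Defensive.

Local Open Scope classical_set_scope.
Local Open Scope card_scope.

(** * Finite sets and Hall's theorem *)

Lemma fset_subset_card (T : choiceType) (F : {fset T}) (k : nat) :
  (k <= #|` F|)%N -> exists2 F0 : {fset T}, (F0 `<=` F)%fset & #|` F0| = k.
Proof.
move=> kF; exists [fset x in take k F]%fset.
  by apply/fsubsetP => x; rewrite !inE => /mem_take.
by rewrite card_fseq undup_id ?take_uniq ?fset_uniq// size_takel.
Qed.

Lemma set_fset_sub (T : choiceType) (F F' : {fset T}) :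
  (F `<=` F')%fset <-> [set` F] `<=` [set` F'].
Proof. by split=> [/fsubsetP sF x /sF|sF]//; apply/fsubsetP => x /sF. Qed.

Lemma cardfsU_disjoint (T : choiceType) (A B : {fset T}) :
  [disjoint A & B]%fset -> #|` (A `|` B)%fset| = (#|` A| + #|` B|)%N.
Proof. by move=> /eqP AB; rewrite cardfsU AB cardfs0 subn0. Qed.

(** Hall's condition is put in a form symmetric in the two sides: a rectangle
    [J] x [L] that avoids [r] has [|J| + |L| <= |Y|].  Induction on [|X|]: match
    some [x] with some [y] and continue, unless this creates a rectangle
    violating the condition for [Y] without [y].  Such a rectangle is tight for
    [Y], that is [|J| + |L| = |Y|], and then the problem splits into the
    independent problems of matching [J] into [Y] minus [L] and [X] minus [J]
    into [L].  The values are options because [U] may be empty. *)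
Lemma hall_matching (T U : choiceType) (r : T -> U -> Prop)
    (X : {fset T}) (Y : {fset U}) :
  (forall (J : {fset T}) (L : {fset U}), (J `<=` X)%fset -> (L `<=` Y)%fset ->
    (forall x y, x \in J -> y \in L -> ~ r x y) ->
    (#|` J| + #|` L| <= #|` Y|)%N) ->
  exists f : T -> option U,
    {in X &, injective f} /\
    forall x, x \in X -> exists y, [/\ f x = Some y, y \in Y & r x y].
Proof.
move: {2}#|` X| (leqnn #|` X|) => m.
elim: m X Y => [|m IHm] X Y.
  rewrite leqn0 => /eqP/cardfs0_eq-> _; exists (fun=> None).
  by split=> x; rewrite inE.
move=> Xm H.
have [->|/fset0Pn[x xX]] := eqVneq X fset0.
  by exists (fun=> None); split=> x; rewrite inE.
have [y yY rxy] : exists2 y, y \in Y & r x y.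
  apply: contrapT => nY.
  suff : (#|` [fset x]%fset| + #|` Y| <= #|` Y|)%N.
    by rewrite cardfs1 add1n ltnn.
  apply: H => //; first by rewrite fsub1set.
  move=> a b; rewrite inE => /eqP-> bY rab; by apply: nY; exists b.
have Xx : (#|` (X `\ x)%fset| <= m)%N.
  by move: Xm; rewrite (cardfsD1 x) xX.
have [Hxy|] := pselect (forall (J : {fset T}) (L : {fset U}),
    (J `<=` X `\ x)%fset -> (L `<=` Y `\ y)%fset ->
    (forall x y, x \in J -> y \in L -> ~ r x y) ->
    (#|` J| + #|` L| <= #|` (Y `\ y)%fset|)%N).
  have [f [finj fr]] := IHm _ _ Xx Hxy.
  exists (fun z => if z == x then Some y else f z); split.
    move=> a b aX bX; case: (eqVneq a x) => [->|ax]; case: (eqVneq b x) => [->|bx] //.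
    - have /fr[y' [-> y'Y _]] : b \in (X `\ x)%fset by rewrite !inE bx.
      by move=> [yy']; move: y'Y; rewrite -yy' !inE eqxx.
    - have /fr[y' [-> y'Y _]] : a \in (X `\ x)%fset by rewrite !inE ax.
      by move=> [yy']; move: y'Y; rewrite yy' !inE eqxx.
    - by apply: finj; rewrite !inE ?ax ?bx.
  move=> a aX; case: (eqVneq a x) => [->|ax]; first by exists y.
  have /fr[y' [-> + ry']] : a \in (X `\ x)%fset by rewrite !inE ax.
  by rewrite !inE => /andP[_ y'Y]; exists y'.
(* The offending rectangle J x L is tight, and the problem splits along it. *)
move=> /existsNP[J] /existsNP[L] /not_implyP[JX] /not_implyP[LY].
move=> /not_implyP[JL] /negP; rewrite -ltnNge => Hlt.
have JX' : (J `<=` X)%fset by apply: fsubset_trans JX (fsubD1set _ _).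
have LY' : (L `<=` Y)%fset by apply: fsubset_trans LY (fsubD1set _ _).
have xJ : x \notin J.
  by apply/negP => /(fsubsetP JX); rewrite !inE eqxx.
have eJL : (#|` J| + #|` L| = #|` Y|)%N.
  apply/eqP; rewrite eqn_leq (H J L)//=.
  by rewrite (cardfsD1 y Y) yY add1n.
have Jm : (#|` J| <= m)%N by apply: leq_trans Xx; apply: fsubset_leq_card.
have J0 : (0 < #|` J|)%N.
  rewrite lt0n; apply/eqP => J0; move: Hlt; rewrite J0 add0n ltnNge.
  by rewrite fsubset_leq_card.
have XJm : (#|` (X `\` J)%fset| <= m)%N.
  rewrite cardfsDS// leq_subLR; apply: (leq_trans Xm).
  by rewrite -add1n leq_add2r.
have cYL : #|` (Y `\` L)%fset| = #|` J|.
  by rewrite cardfsDS// -eJL addnK.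
have [|f [finj fr]] := IHm J (Y `\` L)%fset Jm.
  move=> J' L' sJ sL nr.
  rewrite cYL -(leq_add2r #|` L|) eJL -addnA.
  have dL : [disjoint L' & L]%fset.
    apply/fdisjointP => z /(fsubsetP sL); by rewrite !inE => /andP[].
  rewrite -(cardfsU_disjoint dL).
  apply: H => //.
  - exact: fsubset_trans JX'.
  - rewrite fsubUset LY' andbT; apply: fsubset_trans sL (fsubsetDl _ _).
  - move=> a b aJ; rewrite inE => /orP[|bL]; first exact: nr.
    by apply: JL => //; apply: (fsubsetP sJ).
have [|g [ginj gr]] := IHm (X `\` J)%fset L XJm.
  move=> J' L' sJ sL nr.
  rewrite -(leq_add2l #|` J|) eJL addnA.
  have dJ : [disjoint J & J']%fset.
    rewrite fdisjoint_sym; apply/fdisjointP => z /(fsubsetP sJ); by rewrite !inE => /andP[].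
  rewrite -(cardfsU_disjoint dJ).
  apply: H => //.
  - rewrite fsubUset JX' /=; apply: fsubset_trans sJ (fsubsetDl _ _).
  - exact: fsubset_trans LY'.
  - move=> a b; rewrite inE => /orP[aJ bL|]; last exact: nr.
    by apply: JL => //; apply: (fsubsetP sL).
exists (fun z => if z \in J then f z else g z); split.
  have fg a b : a \in J -> b \in X -> b \notin J -> f a <> g b.
    move=> /fr[y1 [-> + _]] bX bJ; rewrite inE => /andP[y1L _].
    have /gr[y2 [-> y2L _]] : b \in (X `\` J)%fset by rewrite inE bJ.
    by move=> [] e; rewrite e y2L in y1L.
  move=> a b aX bX; case: ifP => aJ; case: ifP => bJ.
  - exact: finj.
  - by move/fg; rewrite bJ; case.
  - by move/esym/fg; rewrite aJ; case.
  - by apply: ginj; rewrite inE ?aJ ?bJ.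
move=> a aX; case: ifP => aJ.
  have [y1 [-> + ?]] := fr _ aJ; rewrite inE => /andP[_ ?].
  by exists y1.
have /gr[y2 [-> /(fsubsetP LY') ? ?]] : a \in (X `\` J)%fset by rewrite inE aJ.
by exists y2.
Qed.

Lemma cardinal_sum_II (T U : choiceType) (X : set T) (Y : set U) (a b : nat) :
  X #= `I_a -> Y #= `I_b -> cardinal_sum X Y #= `I_(a + b).
Proof.
move=> Xa Yb.
have /finite_fsetP[F eX] : finite_set X by apply/finite_setP; exists a.
have /finite_fsetP[F' eY] : finite_set Y by apply/finite_setP; exists b.
subst X Y; move/card_eq_fsetP: Xa => <-; move/card_eq_fsetP: Yb => <-.
have -> : cardinal_sum [set` F] [set` F'] =
    [set` ((inl @` F) `|` (inr @` F'))%fset].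
  rewrite set_fsetU; congr (_ `|` _); apply/seteqP; split=> x /=.
  - by case=> y yF <-; apply: in_imfset.
  - by move=> /imfsetP[y yF ->]; exists y.
  - by case=> y yF <-; apply: in_imfset.
  - by move=> /imfsetP[y yF ->]; exists y.
apply/card_eq_fsetP.
have d : [disjoint (inl @` F : {fset T + U}) & (inr @` F')]%fset.
  apply/fdisjointP => _ /imfsetP[x _ ->]; apply/negP.
  by move=> /imfsetP[].
rewrite (cardfsU_disjoint d) card_imfset/=; last by move=> x y [].
by rewrite card_imfset//= => x y [].
Qed.

(** * Finite rank in a finitary matroid *)

(** The rank as the largest size of a finite independent subset.  Unlike the
    size of a chosen basis, this is visibly unique and monotone, and it gives
    natural numbers to calculate with; [has_rankP] compares the two. *)
Definition has_rank (E : choiceType) (I : set (set E)) (A : set E) (k : nat) :=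
  (exists F : {fset E}, [/\ [set` F] `<=` A, I [set` F] & #|` F| = k]) /\
  forall F : {fset E}, [set` F] `<=` A -> I [set` F] -> (#|` F| <= k)%N.

Section Matroid.
Variables (E : choiceType) (I : set (set E)) (mI : finitary_matroid I).
Implicit Types (A B X Y : set E) (F : {fset E}).

Lemma indep_fset0 : I [set` fset0].
Proof.
by have [Z IZ] := indep_nonempty mI; apply: (indep_sub mI IZ) => x /=; rewrite inE.
Qed.

Lemma fset_augment F F' : I [set` F] -> I [set` F'] -> (#|` F| < #|` F'|)%N ->
  exists x, [/\ x \in F', x \notin F & I [set` (x |` F)%fset]].
Proof.
move=> IF IF' /fset_subset_card[F0 sF0 cF0].
have [||x [[/= xF0 xF] Ix]] := indep_exchange mI (k := #|` F|) IF
    (indep_sub mI IF' ((set_fset_sub _ _).1 sF0)).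
- exact/card_eq_fsetP.
- exact/card_eq_fsetP.
by exists x; rewrite set_fsetU1; split=> //; [exact: (fsubsetP sF0)|exact/negP].
Qed.


Lemma has_rank_uniq A k l : has_rank I A k -> has_rank I A l -> k = l.
Proof.
move=> [[F [FA IF cF]] kmax] [[F' [FA' IF' cF']] lmax].
by apply/eqP; rewrite eqn_leq -{1}cF -{2}cF' lmax ?kmax.
Qed.

Lemma bounded_has_rank A m :
  (forall F, [set` F] `<=` A -> I [set` F] -> (#|` F| <= m)%N) ->
  exists2 k, (k <= m)%N & has_rank I A k.
Proof.
move=> Am.
pose P k := `[< exists F, [/\ [set` F] `<=` A, I [set` F] & #|` F| = k] >].
have P0 : exists k, P k.
  exists 0%N; apply/asboolP; exists fset0; split=> [x /=| |].
  - by rewrite inE.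
  - exact: indep_fset0.
  - exact: cardfs0.
have Pm k : P k -> (k <= m)%N by move=> /asboolP[F [FA IF <-]]; exact: Am.
case: (ex_maxnP P0 Pm) => k Pk kmax; exists k; first exact: Pm.
split=> [|F FA IF]; first exact/asboolP.
by apply: kmax; apply/asboolP; exists F.
Qed.

Lemma has_rank_sub A A' k : A `<=` A' -> has_rank I A' k ->
  exists2 j, (j <= k)%N & has_rank I A j.
Proof.
move=> AA' [_ kmax]; apply: bounded_has_rank => F FA; apply: kmax.
exact: subset_trans AA'.
Qed.

Lemma has_rank_setU1 A k x : has_rank I A k -> exists m, has_rank I (A `|` [set x]) m.
Proof.
move=> [_ kmax].
have [|m _ Am] := @bounded_has_rank (A `|` [set x]) k.+1; last by exists m.
move=> F FA IF; rewrite (cardfsD1 x) -add1n leq_add ?leq_b1//.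
apply: kmax => [y|].
  by rewrite /= !inE => /andP[/eqP yx /FA[]].
by apply: (indep_sub mI IF); apply/set_fset_sub; exact: fsubD1set.
Qed.

Lemma has_rank_extend A k F : has_rank I A k -> [set` F] `<=` A -> I [set` F] ->
  exists F', [/\ (F `<=` F')%fset, [set` F'] `<=` A, I [set` F'] & #|` F'| = k].
Proof.
move=> [[B [BA IB cB]] kmax].
move: {2}(k - #|` F|)%N (leqnn (k - #|` F|)) => d.
elim: d F => [|d IHd] F.
  rewrite leqn0 subn_eq0 => kF FA IF; exists F; split=> //.
  by apply/eqP; rewrite eqn_leq kF kmax.
move=> dk FA IF.
have [kF|Fk] := leqP k #|` F|.
  by exists F; split=> //; apply/eqP; rewrite eqn_leq kF kmax.
have [|x [xB xF Ix]] := fset_augment IF IB; first by rewrite cB.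
have [||F' [xFF' F'A IF' cF']] := IHd (x |` F)%fset _ _ Ix.
- by rewrite cardfsU1 xF add1n subnS -subn1 leq_subLR add1n.
- by rewrite set_fsetU1 => y [->|/FA//]; exact: BA.
by exists F'; split=> //; apply: fsubset_trans xFF'; exact: fsubsetU1.
Qed.

Lemma dependent_of_max A k F x : has_rank I A k -> [set` F] `<=` A ->
  #|` F| = k -> A x -> x \notin F -> ~ I [set` (x |` F)%fset].
Proof.
move=> [_ kmax] FA cF Ax xF Ix.
have : (#|` (x |` F)%fset| <= k)%N.
  by apply: kmax => //; rewrite set_fsetU1 => y [->|/FA].
by rewrite cardfsU1 xF cF add1n ltnn.
Qed.

Lemma basis_of_has_rank A k F : has_rank I A k -> [set` F] `<=` A -> I [set` F] ->
  #|` F| = k -> is_basis I A [set` F].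
Proof.
move=> rA FA IF cF; split=> // Y YA IY FY; apply/seteqP; split=> // y Yy /=.
apply/negPn/negP => yF; apply: (dependent_of_max rA FA cF (YA _ Yy) yF).
by apply: (indep_sub mI IY); rewrite set_fsetU1 => z [->|/FY].
Qed.

Lemma has_rank_of_basis F A : is_basis I A [set` F] -> has_rank I A #|` F|.
Proof.
move=> [FA IF Fmax]; split=> [|F' FA' IF']; first by exists F.
rewrite leqNgt; apply/negP => /(fset_augment IF IF')[x [xF' /negP xF Ix]].
apply: xF; suff /seteqP[xFF _] : [set` (x |` F)%fset] = [set` F].
  by apply: xFF; rewrite /= !inE eqxx.
apply: Fmax => //; rewrite set_fsetU1; last exact: subsetUr.
by move=> y [->|/FA//]; exact: FA'.
Qed.

Lemma finite_basis A k X : has_rank I A k -> is_basis I A X ->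
  exists2 F, X = [set` F] & #|` F| = k.
Proof.
move=> rA bX; have [XA IX _] := bX.
have [fX|/(infinite_set_fset k.+1)[F FX kF]] := pselect (finite_set X).
  have /finite_fsetP[F eX] := fX; exists F => //.
  by apply: has_rank_uniq rA; apply: has_rank_of_basis; rewrite -eX.
have := rA.2 F (subset_trans FX XA) (indep_sub mI IX FX).
by rewrite leqNgt kF.
Qed.

Lemma rank_is_basis A : is_basis I A (rank I A).
Proof. exact: (xgetPex set0 (ex_basis A mI)). Qed.

(** An infinite basis cannot occur in finite rank, since its finite subsets
    would be independent of arbitrary size; so the chosen basis representing
    the cardinal rank has [k] elements. *)
Lemma has_rankP A k : has_rank I A k <-> rank I A #= `I_k.
Proof.
split=> [rA|rk].
  by have [F -> cF] := finite_basis rA (rank_is_basis A); exact/card_eq_fsetP.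
have /finite_fsetP[F eF] : finite_set (rank I A) by apply/finite_setP; exists k.
have := rank_is_basis A; move: rk; rewrite eF => /card_eq_fsetP <-.
exact: has_rank_of_basis.
Qed.

Lemma modular_has_rank (hm : modular I) X Y a b c d : flat I X -> flat I Y ->
  has_rank I X a -> has_rank I Y b ->
  has_rank I (X `|` Y) c -> has_rank I (X `&` Y) d -> (a + b = c + d)%N.
Proof.
move=> fX fY /has_rankP ra /has_rankP rb /has_rankP rc /has_rankP rd.
apply/card_eq_II; rewrite -(card_eql (cardinal_sum_II ra rb)).
by rewrite -(card_eqr (cardinal_sum_II rc rd)); exact: hm.
Qed.

(** * Closure and flats *)

Lemma sub_cl A : A `<=` cl I A.
Proof. by move=> x; left. Qed.

Lemma cl_mono A B : A `<=` B -> cl I A `<=` cl I B.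
Proof.
move=> AB x [/AB|[_ [X [IX XA nI]]]]; first by left.
have [Bx|nBx] := pselect (B x); first by left.
by right; split=> //; exists X; split=> //; exact: subset_trans AB.
Qed.

Lemma cl_min A B : A `<=` B -> flat I B -> cl I A `<=` B.
Proof. by move=> /cl_mono + fB; rewrite fB. Qed.

Lemma flat_setI A B : flat I A -> flat I B -> flat I (A `&` B).
Proof.
move=> fA fB; apply/seteqP; split; last exact: sub_cl.
by move=> x cx; split; move: x cx; apply: cl_min.
Qed.

(** The definition of dependence lets the independent subset of [A] vary; in
    finite rank a single basis [F] of [A] detects all dependences.  That the
    closure is determined by [F] alone gives idempotence ([flat_cl]): [F] is
    also a basis of [cl I A]. *)
Lemma cl_basis A k F : has_rank I A k -> [set` F] `<=` A -> I [set` F] ->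
  #|` F| = k -> cl I A = [set x | x \in F \/ ~ I [set` (x |` F)%fset]].
Proof.
move=> rA FA IF cF; apply/seteqP; split=> x; last first.
  case=> [xF|nI]; first by left; exact: FA.
  have [Ax|nAx] := pselect (A x); first by left.
  by right; split=> //; exists [set` F]; split=> //; rewrite -set_fsetU1.
have [xF _|/negP xF] := boolP (x \in F); first by left.
case=> [Ax|[nAx [B [IB BA nI]]]]; right.
  by apply: dependent_of_max rA FA cF Ax _; exact/negP.
move=> Ix; apply: nI.
have /finite_fsetP[B' eB] : finite_set B.
  apply: contrapT => /(infinite_set_fset k.+1)[F' FB kF].
  have := rA.2 F' (subset_trans FB BA) (indep_sub mI IB FB).
  by rewrite leqNgt kF.
subst B; have [F' [BF' F'A IF' cF']] := has_rank_extend rA BA IB.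
have [|y [yxF yF' Iy]] := fset_augment IF' Ix.
  by rewrite cF' cardfsU1 (introN idP xF) cF add1n.
move: yxF; rewrite !inE => /orP[/eqP yx|yF].
  apply: (indep_sub mI Iy); rewrite yx set_fsetU1 => z [->|zB]; first by left.
  by right; exact: (fsubsetP BF').
by case: (dependent_of_max rA F'A cF' (FA _ yF) yF').
Qed.

Lemma has_rank_cl A k : has_rank I A k -> has_rank I (cl I A) k.
Proof.
move=> rA; have [[F [FA IF cF]] _] := rA.
have clA := cl_basis rA FA IF cF.
split=> [|F' F'A IF']; first by exists F; split=> //; apply: subset_trans (@sub_cl A).
rewrite leqNgt -cF; apply/negP => /(fset_augment IF IF')[x [/F'A + xF Ix]].
by rewrite clA => -[|//]; exact/negP.
Qed.

Lemma flat_cl A k : has_rank I A k -> flat I (cl I A).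
Proof.
move=> rA; have [[F [FA IF cF]] _] := rA; rewrite /flat.
rewrite (cl_basis (has_rank_cl rA) (subset_trans FA (@sub_cl A)) IF cF).
by rewrite (cl_basis rA FA IF cF).
Qed.

Lemma flat_sub_eq A B k : flat I A -> A `<=` B -> has_rank I A k ->
  has_rank I B k -> B `<=` A.
Proof.
move=> fA AB rA rB x Bx; have [[F [FA IF cF]] _] := rA.
rewrite -fA (cl_basis rA FA IF cF) /=.
have [xF|xF] := boolP (x \in F); [by left|right].
exact: dependent_of_max rB (subset_trans FA AB) cF Bx xF.
Qed.

(** The flats [R] and [B] together span [cl (B `|` {x})], so modularity
    expresses the rank of [R `&` B] through that of [R] up to a constant; no
    distinction is made between [x] inside and outside [B]. *)
Lemma has_rank_setI_hyperplane (hm : modular I) B R x n m r : flat I B -> flat I R ->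
  R x -> R `<=` cl I (B `|` [set x]) -> has_rank I B n ->
  has_rank I (B `|` [set x]) m -> has_rank I R r ->
  exists2 t, has_rank I (R `&` B) t & (r + n = m + t)%N.
Proof.
move=> fB fR Rx RB rB rBx rR.
have RBcl : R `|` B `<=` cl I (B `|` [set x]).
  by rewrite subUset; split=> // y By; apply: sub_cl; left.
have [c cm rc] := has_rank_sub RBcl (has_rank_cl rBx).
have BxRB : B `|` [set x] `<=` R `|` B by move=> y [By|->]; [right|left].
have [m' m'c rm'] := has_rank_sub BxRB rc.
have {}cm : c = m.
  by apply/eqP; rewrite eqn_leq cm (has_rank_uniq rBx rm').
have [t _ rt] := has_rank_sub (@subIsetr _ R B) rB.
by exists t => //; apply: (modular_has_rank hm fR fB rR rB _ rt); rewrite -cm.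
Qed.

End Matroid.

Lemma hall_bijection (T : choiceType) (r : T -> T -> Prop) (X Y : {fset T}) :
  #|` X| = #|` Y| ->
  (forall J L : {fset T}, (J `<=` X)%fset -> (L `<=` Y)%fset ->
    (forall x y, x \in J -> y \in L -> ~ r x y) ->
    (#|` J| + #|` L| <= #|` Y|)%N) ->
  exists f : T -> T, set_bij [set` X] [set` Y] f /\
    forall x, x \in X -> r x (f x).
Proof.
move=> cXY /hall_matching[f [finj fr]].
pose g x := odflt x (f x).
have gE x : x \in X -> f x = Some (g x).
  by move=> /fr[y [fy _ _]]; rewrite /g fy.
have gY x : x \in X -> g x \in Y.
  by move=> xX; have [y [fy yY _]] := fr x xX; rewrite /g fy.
have ginj : {in X &, injective g}.
  by move=> x y xX yX gxy; apply: finj => //; rewrite !gE// gxy.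
exists g; split; last first.
  by move=> x xX; have [y [fy _ rxy]] := fr x xX; rewrite /g fy.
split.
- by move=> x /= /gY.
- by move=> x y /set_mem xX /set_mem yX; exact: ginj.
move=> y /= yY.
have : (g @` X)%fset == Y.
  rewrite eqEfcard card_in_imfset//= cXY leqnn andbT.
  by apply/fsubsetP => _ /imfsetP[x xX ->]; exact: gY.
move=> /eqP eY; move: yY; rewrite -eY => /imfsetP[x xX ->].
by exists x.
Qed.

(** * Independence groups *)

Section Group.
Variables (G : groupType) (I : set (set G)) (iG : independence_group I).
Implicit Types (A B S R : set G) (g : G).

Local Notation "g *: A" := [set (g * x)%g | x in A].

Let mI : finitary_matroid I := indep_matroid iG.

Lemma translateK g A : g^-1%g *: (g *: A) = A.
Proof.
apply/seteqP; split=> [_ [_ [x Ax <-] <-]|x Ax]; first by rewrite mulKg.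
by exists (g * x)%g; [exists x|rewrite mulKg].
Qed.

Lemma cl_translate g A x : cl I A x -> cl I (g *: A) (g * x)%g.
Proof.
move=> [Ax|[nAx [B [IB BA nI]]]]; first by left; exists x.
right; split; first by move=> [y Ay /mulgI yx]; apply: nAx; rewrite -yx.
exists (g *: B); split; first exact/(indep_translate iG).
  by move=> _ [y /BA Ay <-]; exists y.
move=> Ig; apply/nI/(indep_translate iG g).
by rewrite image_setU image_set1.
Qed.

Lemma flat_translate g A : flat I A -> flat I (g *: A).
Proof.
move=> fA; apply/seteqP; split; last exact: sub_cl.
move=> x cx; have := cl_translate g^-1%g cx; rewrite translateK fA => Ax.
by exists (g^-1 * x)%g; rewrite ?mulVKg.
Qed.

Lemma fset_translate g (F : {fset G}) :
  [set` [fset (g * x)%g | x in F]%fset] = g *: [set` F].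
Proof.
apply/seteqP; split=> [_ /imfsetP[x xF ->]|_ [x xF <-]]; first by exists x.
exact: in_imfset.
Qed.

Lemma has_rank_translate g A k : has_rank I A k -> has_rank I (g *: A) k.
Proof.
have cardt h (F : {fset G}) : #|` [fset (h * x)%g | x in F]%fset| = #|` F|.
  by rewrite card_imfset//=; exact: mulgI.
move=> [[F [FA IF cF]] kmax]; split=> [|F' F'A IF'].
  exists [fset (g * x)%g | x in F]%fset; rewrite cardt fset_translate.
  split=> //; first by move=> _ [x /FA Ax <-]; exists x.
  exact/(indep_translate iG).
rewrite -(cardt g^-1%g); apply: kmax; rewrite fset_translate.
  by move=> _ [_ /F'A[x Ax <-] <-]; rewrite mulKg.
exact/(indep_translate iG).
Qed.

(** For each [s] in [S] the set [s^-1 A] is a flat containing [R], hence it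
    contains [cl I R] as well. *)
Lemma set_mul_cl A S R : flat I A -> set_mul S R `<=` A ->
  set_mul S (cl I R) `<=` A.
Proof.
move=> fA SRA _ [s Ss [x cRx <-]].
rewrite -fA; apply: cl_mono (cl_translate s cRx).
by move=> _ [y Ry <-]; apply: SRA; exists s => //; exists y.
Qed.

End Group.

Lemma set_mulC (G : groupType) (S R : set G) :
  (forall x y : G, x * y = y * x)%g -> set_mul S R = set_mul R S.
Proof.
move=> mulC.
by apply/seteqP; split=> _ [x Sx [y Ry <-]]; exists y => //; exists x.
Qed.

(** * The Dyson transform *)

Section Abelian.
Variables (G : groupType) (I : set (set G)).
Variable (hG : modular_abelian_independence_group I).
Implicit Types (A B S R : set G) (g : G).

Let iG : independence_group I := mai_group hG.
Let mI : finitary_matroid I := indep_matroid iG.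
Let mulgC : forall x y : G, (x * y = y * x)%g := mai_abelian hG.

(** A pair [(S', R')] of minimal [rho R'] among the iterated Dyson transforms
    of [(S, R)] is stable.  Commutativity enters in the check that [S' R'] is
    inside [A]: for [x] in [R] with [e x] in [S], and [w] in [R],
    [x (e w) = (e x) w] belongs to [S R]. *)
Lemma dyson_stable_pair A n S R s r : flat I A -> has_rank I A n ->
  flat I S -> flat I R -> S !=set0 -> R 1%g -> S `<=` A ->
  set_mul S R `<=` A -> has_rank I S s -> has_rank I R r ->
  exists S' R' s' r',
    [/\ flat I S', flat I R', S' !=set0, R' 1%g & S' `<=` A] /\
    [/\ R' `<=` R, set_mul S' R' = S', has_rank I S' s', has_rank I R' r' &
      (s' + r' = s + r)%N].
Proof.
move=> fA rA; elim/ltn_ind: r S R s => r IHr S R s fS fR S0 R1 SA SRA rS rR.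
have [SRS|/existsNP[z /not_implyP[[e Se [t Rt etz]] nSz]]] :=
    pselect (set_mul S R `<=` S).
  exists S, R, s, r; do 2 split=> //.
  apply/seteqP; split=> // x Sx; exists x => //; exists 1%g => //.
  by rewrite mulg1.
pose eR := [set (e * x)%g | x in R].
pose R' := R `&` [set x | S (e * x)%g].
have eReA : eR `<=` A.
  by move=> _ [x Rx <-]; apply: SRA; exists e => //; exists x.
have UA : S `|` eR `<=` A by rewrite subUset.
have feR : flat I eR by exact: flat_translate.
have eR' : [set (e * x)%g | x in R'] = S `&` eR.
  apply/seteqP; split=> [_ [x [Rx Sx] <-]|y [Sy [x Rx exy]]].
    by split=> //; exists x.
  by exists x => //; split=> //=; rewrite exy.
have fR' : flat I R'.
  rewrite -(translateK e R') eR'.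
  by apply: (flat_translate iG); exact: flat_setI.
have [u _ rU] := has_rank_sub mI UA rA.
have [r' r'r rR'] : exists2 r', (r' <= r)%N & has_rank I R' r'.
  by apply: (has_rank_sub mI) rR; exact: subIsetl.
have sum : (s + r = u + r')%N.
  apply: (modular_has_rank mI (mai_modular hG) fS feR rS _ rU).
    exact: has_rank_translate.
  by rewrite -eR'; exact: has_rank_translate.
(* Equal ranks would force R' = R, hence e t in S. *)
have {}r'r : (r' < r)%N.
  rewrite ltn_neqAle r'r andbT; apply/eqP => e_r; apply: nSz; rewrite -etz.
  rewrite e_r in rR'.
  by have [] := flat_sub_eq mI fR' (@subIsetl _ R _) rR' rR Rt.
have S'A : cl I (S `|` eR) `<=` A by exact: cl_min.
have S'R'A : set_mul (cl I (S `|` eR)) R' `<=` A.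
  rewrite (set_mulC _ _ mulgC); apply: (set_mul_cl iG) => //.
  move=> _ [x [Rx Sx] [y [Sy|[w Rw <-]] <-]].
    by rewrite mulgC; apply: SRA; exists y => //; exists x.
  rewrite mulgA [(x * e)%g]mulgC; apply: SRA.
  by exists (e * x)%g => //; exists w.
have [||S' [R'' [s' [r'' [H [R''R' ? ? ? e_sum]]]]]] :=
    IHr _ r'r (cl I (S `|` eR)) R' u (flat_cl mI rU) fR' _ _ S'A S'R'A
      (has_rank_cl mI rU) rR'.
- by exists e; apply: sub_cl; left.
- by split=> //=; rewrite mulg1.
exists S', R'', s', r''; split=> //; split=> //; last by rewrite e_sum sum.
by apply: subset_trans R''R' _; exact: subIsetl.
Qed.

End Abelian.

(** * The matching criterion *)

Theorem theorem6p4 (G : groupType) (I : set (set G)) (n : nat) (A B : set G)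
    (hG : modular_abelian_independence_group I) (hn : (0 < n)%N)
    (fA : flat I A) (fB : flat I B)
    (rA : rank I A #= `I_n) (rB : rank I B #= `I_n) :
  matched I A B <->
  forall S R : set G,
    S !=set0 -> R !=set0 -> flat I S -> flat I R ->
    S `<=` A -> R `<=` cl I (B `|` [set 1%g]) -> set_mul S R = S ->
    cardinal_sum (rank I S) (rank I (R `&` B)) #<= `I_n.
Proof.
have iG := mai_group hG; have mI := indep_matroid iG.
have {}rA : has_rank I A n by exact/has_rankP.
have {}rB : has_rank I B n by exact/has_rankP.
split=> [AB S R _ _ fS fR SA RB SRS|H X Y bX bY].
  have [s _ rS] := has_rank_sub mI SA rA.
  have [t _ rT] := has_rank_sub mI (@subIsetr _ R B) rB.
  have sum := cardinal_sum_II ((has_rankP mI _ _).1 rS) ((has_rankP mI _ _).1 rT).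
  rewrite (card_le_eql sum) card_le_II.
  have [[J [JS IJ <-]] _] := rS; have [[L [LRB IL <-]] _] := rT.
  have [X [JX XA IX cX]] := has_rank_extend mI rA (subset_trans JS SA) IJ.
  have [Y [LY YB IY cY]] :=
    has_rank_extend mI rB (subset_trans LRB (@subIsetr _ R B)) IL.
  have [f [[fXY finj _] fA']] := AB _ _ (basis_of_has_rank mI rA XA IX cX)
    (basis_of_has_rank mI rB YB IY cY).
  (* f sends J into Y but off L, because a f(a) is outside A while J L is
     inside S R = S. *)
  have cfJ : #|` [fset f x | x in J]%fset| = #|` J|.
    rewrite card_in_imfset//= => x y xJ yJ; apply: finj; apply/mem_set.
      exact: (fsubsetP JX).
    exact: (fsubsetP JX).
  rewrite -cfJ -cardfsU_disjoint.
    rewrite -cY; apply: fsubset_leq_card; rewrite fsubUset LY andbT.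
    apply/fsubsetP => _ /imfsetP[x xJ ->]; apply: fXY; exact: (fsubsetP JX).
  apply/fdisjointP => _ /imfsetP[x /= xJ ->]; apply/negP => fxL.
  apply: (fA' x); first exact: (fsubsetP JX).
  apply: SA; rewrite -SRS; exists x; first exact: JS.
  by exists (f x) => //; have [] := LRB _ fxL.
have [FX eX cX] := finite_basis mI rA bX; have [FY eY cY] := finite_basis mI rB bY.
subst X Y; have [XA IX _] := bX; have [YB IY _] := bY.
have [|f [fbij fr]] := hall_bijection (r := fun x y => ~ A (x * y)%g)
  (etrans cX (esym cY)); last by exists f.
move=> J L JX LY JL; rewrite cY leqNgt; apply/negP => nJL.
have {}JL : set_mul [set` J] [set` L] `<=` A.
  by move=> _ [x xJ [y yL <-]]; apply: contrapT; exact: JL.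
have JA : [set` J] `<=` A.
  by apply: subset_trans XA; exact/set_fset_sub.
have LB : [set` L] `<=` B.
  by apply: subset_trans YB; exact/set_fset_sub.
have IJ : I [set` J] by apply: (indep_sub mI IX); exact/set_fset_sub.
have IL : I [set` L] by apply: (indep_sub mI IY); exact/set_fset_sub.
(* J and L are now a Hall violation; the pair to be transformed is
   cl J and cl (L u {1}). *)
have [m rm] := has_rank_setU1 mI 1%g rB.
have LB1 : [set` L] `|` [set 1%g] `<=` B `|` [set 1%g] by exact: setSU.
have [j _ rJ] := has_rank_sub mI JA rA.
have [l _ rL] := has_rank_sub mI LB1 rm.
(* |L| <= n, so the violation forces J, and hence S, to be nonempty. *)
have /fset0Pn[x0 x0J] : J != fset0.
  rewrite -cardfs_gt0 lt0n; apply/eqP => J0.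
  by move: nJL; rewrite J0 ltnNge (rB.2 L LB IL).
have R0B : cl I ([set` L] `|` [set 1%g]) `<=` cl I (B `|` [set 1%g]).
  exact: cl_mono.
have R01 : cl I ([set` L] `|` [set 1%g]) 1%g by apply: sub_cl; right.
have S0R0A : set_mul (cl I [set` J]) (cl I ([set` L] `|` [set 1%g])) `<=` A.
  rewrite (set_mulC _ _ (mai_abelian hG)); apply: (set_mul_cl iG) => //.
  rewrite (set_mulC _ _ (mai_abelian hG)); apply: (set_mul_cl iG) => //.
  move=> _ [x xJ [y [yL|->] <-]]; last by rewrite mulg1; exact: JA.
  by apply: JL; exists x => //; exists y.
have [|S [R [s [r [[fS fR S0 R1 SA] [RR0 SRS rS rR sum]]]]]] :=
  dyson_stable_pair hG fA rA (flat_cl mI rJ) (flat_cl mI rL) _ R01 (cl_min JA fA)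
    S0R0A (has_rank_cl mI rJ) (has_rank_cl mI rL).
  by exists x0; apply: sub_cl.
have RB := subset_trans RR0 R0B.
have [t0 rt0 e0] := has_rank_setI_hyperplane mI (mai_modular hG) fB (flat_cl mI rL)
  R01 R0B rB rm (has_rank_cl mI rL).
have [t rt e1] := has_rank_setI_hyperplane mI (mai_modular hG) fB fR R1 RB rB rm rR.
have Lt0 : (#|` L| <= t0)%N.
  apply: rt0.2 => // y yL; split; last exact: LB.
  by apply: sub_cl; left.
have Jj : (#|` J| <= j)%N by exact: rJ.2.
have := H S R S0 (ex_intro _ _ R1) fS fR SA RB SRS.
have st := cardinal_sum_II ((has_rankP mI _ _).1 rS) ((has_rankP mI _ _).1 rt).
rewrite (card_le_eql st) card_le_II; lia.
Qed.
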